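(* Let $f:[0,1]\to\mathbb{R}$ be twice continuously differentiable on $[0,1]$. Then $$\lim_{n\to\infty} n\big(R_n(f;x)-f(x)\big)=\frac12 f''(x)\,x(1-x)\big(1-\min\{x,1-x\}\big),\qquad x\in[0,1].$$
   Context: For $x,h\in\mathbb{R}$ and an integer $n\ge 0$, the generalized rising factorial with increment $h$ is $x^{(n,h)}=x(x+h)(x+2h)\cdots(x+(n-1)h)$, with the convention $x^{(0,h)}=1$. For an integer $n>1$, a function $f:[0,1]\to\mathbb{R}$ and $x\in[0,1]$, put $c=c(n,x)=-\frac{\min\{x,1-x\}}{n-1}$ and define $$R_n(f;x)=\sum_{k=0}^{n}\binom{n}{k}\frac{x^{(k,c)}\,(1-x)^{(n-k,c)}}{1^{(n,c)}}\,f\left(\frac{k}{n}\right).$$ *)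

(* Defs.v *)
From Stdlib Require Import Reals.
Open Scope R_scope.

(* A function on [0,1] is represented by a total function R -> R; everything
   below only depends on its values on [0,1]. *)
Definition unit_interval (x : R) : Prop := 0 <= x <= 1.

Fixpoint rising (x h : R) (n : nat) : R :=
  match n with
  | O => 1
  | S m => rising x h m * (x + INR m * h)
  end.

(* Meaningful for n > 1 only: at n = 1 the division by zero gives an
   unspecified value. *)
Definition incr_c (n : nat) (x : R) : R := - (Rmin x (1 - x) / (INR n - 1)).

Definition Rop (n : nat) (f : R -> R) (x : R) : R :=
  sum_f_R0
    (fun k =>
       C n k
       * (rising x (incr_c n x) k * rising (1 - x) (incr_c n x) (n - k)
          / rising 1 (incr_c n x) n)
       * f (INR k / INR n))
    n.

(* f is twice continuously differentiable on [0,1], with first and second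
   derivatives f1 and f2 there.  [D_in] and [continue_in] are relative to the
   interval, hence one-sided at 0 and 1. *)
Definition C2_unit (f f1 f2 : R -> R) : Prop :=
  forall x : R, unit_interval x ->
    D_in f f1 unit_interval x
    /\ D_in f1 f2 unit_interval x
    /\ continue_in f2 unit_interval x.

(* Main.v *)
(** The weights of [Rop] form a Polya-Eggenberger distribution on [{0..n}]
    whose factorial moments are explicit by the Vandermonde identity for rising
    factorials.  Hence the node [k/n] has mean [x], [n] times its variance tends to
    [x(1-x)(1-min(x,1-x))], and its fourth central moment is [O(1/n^2)].
    Expanding [f] to second order at [x], the remainder is at most
    [eps (t-x)^2 + A (t-x)^4], so it does not contribute to the limit. *)
Require Import Defs.
From Stdlib Require Import Reals Lra Lia.
Open Scope R_scope.

(** * Moments of the Polya-Eggenberger weights *)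

Lemma rising_S_l (x h : R) (n : nat) :
  rising x h (S n) = x * rising (x + h) h n.
Proof.
  induction n as [|n IH].
  - simpl; ring.
  - change (rising x h (S (S n)))
      with (rising x h (S n) * (x + INR (S n) * h)).
    rewrite IH, S_INR; simpl; ring.
Qed.

Lemma rising_add (x h : R) (j k : nat) :
  rising x h (j + k) = rising x h j * rising (x + INR j * h) h k.
Proof.
  induction k as [|k IH].
  - rewrite Nat.add_0_r; simpl; ring.
  - rewrite Nat.add_succ_r; simpl; rewrite IH, plus_INR; ring.
Qed.

Lemma rising_ge0 (x h : R) (n : nat) :
  (forall i : nat, (i < n)%nat -> 0 <= x + INR i * h) -> 0 <= rising x h n.
Proof.
  induction n as [|n IH]; intros H; simpl; [lra|].
  apply Rmult_le_pos; [apply IH; intros i Hi|]; apply H; lia.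
Qed.

Lemma rising_gt0 (x h : R) (n : nat) :
  (forall i : nat, (i < n)%nat -> 0 < x + INR i * h) -> 0 < rising x h n.
Proof.
  induction n as [|n IH]; intros H; simpl; [lra|].
  apply Rmult_lt_0_compat; [apply IH; intros i Hi|]; apply H; lia.
Qed.

Lemma C_absorb (n k : nat) :
  (k <= n)%nat -> C (S n) (S k) * INR (S k) = INR (S n) * C n k.
Proof.
  intros Hk; unfold C.
  replace (S n - S k)%nat with (n - k)%nat by lia.
  rewrite !fact_simpl, !mult_INR.
  pose proof (INR_fact_neq_0 k); pose proof (INR_fact_neq_0 (n - k)).
  pose proof (not_0_INR (S k) (Nat.neq_succ_0 k)).
  field; auto.
Qed.

Lemma C_absorb_r (n k : nat) :
  (k <= n)%nat -> C (S n) k * INR (S n - k) = INR (S n) * C n k.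
Proof.
  intros Hk; rewrite pascal_step2 by assumption.
  assert (INR (S n - k) <> 0) by (apply not_0_INR; lia).
  field; assumption.
Qed.

Lemma C_ge0 (n k : nat) : 0 <= C n k.
Proof.
  unfold C; apply Rlt_le, Rdiv_lt_0_compat; [apply INR_fact_lt_0|].
  apply Rmult_lt_0_compat; apply INR_fact_lt_0.
Qed.

(** The weights stay unnormalised and [x], [y] independent because the absorption identities shift
    one of them alone, which would break [x + y = 1]. *)
Definition polya_sum (n : nat) (x y c : R) (g : nat -> R) : R :=
  sum_f_R0
    (fun k => C n k * (rising x c k * rising y c (n - k)) * g k) n.

(** The factor [k] kills the term [k = 0]; elsewhere the binomial coefficient absorbs it, and the
    first factor [x] splits off the rising factorial, moving its base to [x + c]. *)
Lemma polya_sum_absorb_l (n : nat) (x y c : R) (g : nat -> R) :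
  polya_sum (S n) x y c (fun k => INR k * g k)
  = INR (S n) * x * polya_sum n (x + c) y c (fun k => g (S k)).
Proof.
  unfold polya_sum; rewrite decomp_sum, scal_sum by lia.
  replace (INR 0) with 0 by reflexivity.
  rewrite Rmult_0_l, Rmult_0_r, Rplus_0_l.
  apply sum_eq; intros k Hk; simpl Init.Nat.pred in Hk.
  replace (S n - S k)%nat with (n - k)%nat by lia.
  rewrite rising_S_l.
  transitivity ((C (S n) (S k) * INR (S k))
    * (x * rising (x + c) c k * rising y c (n - k)) * g (S k)); [ring|].
  rewrite C_absorb by assumption; ring.
Qed.

(** Mirror image: the term [k = n + 1] vanishes and the factor [y] splits off. *)
Lemma polya_sum_absorb_r (n : nat) (x y c : R) (g : nat -> R) :
  polya_sum (S n) x y c (fun k => INR (S n - k) * g k)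
  = INR (S n) * y * polya_sum n x (y + c) c g.
Proof.
  unfold polya_sum; rewrite tech5, scal_sum, Nat.sub_diag.
  replace (INR 0) with 0 by reflexivity.
  rewrite Rmult_0_l, Rmult_0_r, Rplus_0_r.
  apply sum_eq; intros k Hk.
  transitivity ((C (S n) k * INR (S n - k))
    * (rising x c k * rising y c (S n - k)) * g k); [ring|].
  rewrite C_absorb_r by assumption.
  replace (S n - k)%nat with (S (n - k)) by lia.
  rewrite rising_S_l; ring.
Qed.

(* Weighting the two absorption identities by [k] and [n + 1 - k] and adding
   them avoids Pascal's rule. *)
Lemma rising_vandermonde (n : nat) (x y c : R) :
  polya_sum n x y c (fun _ => 1) = rising (x + y) c n.
Proof.
  revert x y; induction n as [|n IH]; intros x y.
  - unfold polya_sum, C; simpl; field.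
  - assert (HS : INR (S n) <> 0) by (apply not_0_INR; lia).
    apply Rmult_eq_reg_l with (INR (S n)); [|assumption].
    transitivity
      (polya_sum (S n) x y c (fun k => INR k * 1)
       + polya_sum (S n) x y c (fun k => INR (S n - k) * 1)).
    + unfold polya_sum; rewrite scal_sum, <- sum_plus.
      apply sum_eq; intros k Hk; rewrite minus_INR by assumption; ring.
    + rewrite polya_sum_absorb_l, polya_sum_absorb_r, !IH, rising_S_l.
      replace (x + c + y) with (x + y + c) by ring.
      replace (x + (y + c)) with (x + y + c) by ring.
      ring.
Qed.

(* [rising u (-1) j] is the falling factorial [u (u-1) ... (u-j+1)]. *)
Lemma polya_sum_falling (j n : nat) (x y c : R) :
  (j <= n)%nat ->
  polya_sum n x y c (fun k => rising (INR k) (-1) j)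
  = rising (INR n) (-1) j * rising x c j
    * rising (x + y + INR j * c) c (n - j).
Proof.
  revert n x; induction j as [|j IH]; intros n x Hj.
  - change (polya_sum n x y c (fun _ => 1)
            = 1 * 1 * rising (x + y + 0 * c) c (n - 0)).
    rewrite rising_vandermonde, Nat.sub_0_r, Rmult_0_l, Rplus_0_r; ring.
  - destruct n as [|n]; [lia|].
    (* Peeling [k] off the falling factorial leaves that of [k - 1], which the index shift in
       [polya_sum_absorb_l] turns back into that of [k]. *)
    transitivity (polya_sum (S n) x y c
      (fun k => INR k * rising (INR k + -1) (-1) j)).
    + apply sum_eq; intros k _; rewrite rising_S_l; reflexivity.
    + rewrite polya_sum_absorb_l.
      transitivity (INR (S n) * x
        * polya_sum n (x + c) y c (fun k => rising (INR k) (-1) j)).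
      * f_equal; apply sum_eq; intros k _; rewrite S_INR.
        replace (INR k + 1 + -1) with (INR k) by ring; reflexivity.
      * rewrite IH by lia.
        rewrite (rising_S_l (INR (S n))), (rising_S_l x), !S_INR.
        replace (INR n + 1 + -1) with (INR n) by ring.
        replace (x + c + y + INR j * c) with (x + y + (INR j + 1) * c) by ring.
        simpl Nat.sub; ring.
Qed.

(** The summand keeps the shape used in [Rop], so that [Rop n f x] is convertible to an instance of
    this mean. *)
Definition polya_mean (n : nat) (x c : R) (g : nat -> R) : R :=
  sum_f_R0
    (fun k => C n k * (rising x c k * rising (1 - x) c (n - k) / rising 1 c n)
              * g k) n.

Lemma polya_mean_ext (n : nat) (x c : R) (g h : nat -> R) :
  (forall k, (k <= n)%nat -> g k = h k) ->
  polya_mean n x c g = polya_mean n x c h.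
Proof.
  intros H; apply sum_eq; intros k Hk; rewrite H by assumption; reflexivity.
Qed.

Lemma polya_mean_plus (n : nat) (x c : R) (g h : nat -> R) :
  polya_mean n x c (fun k => g k + h k)
  = polya_mean n x c g + polya_mean n x c h.
Proof.
  unfold polya_mean; rewrite <- sum_plus; apply sum_eq; intros; ring.
Qed.

Lemma polya_mean_scal (n : nat) (x c a : R) (g : nat -> R) :
  polya_mean n x c (fun k => a * g k) = a * polya_mean n x c g.
Proof.
  unfold polya_mean; rewrite scal_sum; apply sum_eq; intros; ring.
Qed.

Lemma polya_mean_falling (j n : nat) (x c : R) :
  (j <= n)%nat ->
  (forall i : nat, (i < n)%nat -> 0 < 1 + INR i * c) ->
  polya_mean n x c (fun k => rising (INR k) (-1) j)
  = rising (INR n) (-1) j * rising x c j / rising 1 c j.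
Proof.
  intros Hj Hpos.
  (* The last [n - j] factors of [rising 1 c n] form the last factor in [polya_sum_falling] and
     cancel; both parts are nonzero because their product is positive. *)
  assert (Hsplit := rising_add 1 c j (n - j)).
  replace (j + (n - j))%nat with n in Hsplit by lia.
  pose proof (rising_gt0 1 c n Hpos) as Hn.
  assert (Hj0 : rising 1 c j <> 0).
  { intros E; rewrite E in Hsplit; lra. }
  assert (Hr0 : rising (1 + INR j * c) c (n - j) <> 0).
  { intros E; rewrite E in Hsplit; lra. }
  transitivity (/ rising 1 c n
    * polya_sum n x (1 - x) c (fun k => rising (INR k) (-1) j)).
  - unfold polya_mean, polya_sum; rewrite scal_sum; apply sum_eq; intros.
    unfold Rdiv; ring.
  - rewrite polya_sum_falling by assumption.
    replace (x + (1 - x) + INR j * c) with (1 + INR j * c) by ring.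
    rewrite Hsplit; field; auto.
Qed.

(** In the basis of falling factorials the means are explicit, so each moment of degree at most four
    reduces to a choice of five coefficients. *)
Lemma polya_mean_quartic (n : nat) (x c a0 a1 a2 a3 a4 : R) :
  (4 <= n)%nat ->
  (forall i : nat, (i < n)%nat -> 0 < 1 + INR i * c) ->
  polya_mean n x c
    (fun k => a0 + a1 * rising (INR k) (-1) 1 + a2 * rising (INR k) (-1) 2
              + a3 * rising (INR k) (-1) 3 + a4 * rising (INR k) (-1) 4)
  = a0 + a1 * (INR n * x)
    + a2 * (rising (INR n) (-1) 2 * rising x c 2 / rising 1 c 2)
    + a3 * (rising (INR n) (-1) 3 * rising x c 3 / rising 1 c 3)
    + a4 * (rising (INR n) (-1) 4 * rising x c 4 / rising 1 c 4).
Proof.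
  intros Hn Hpos; rewrite !polya_mean_plus, !polya_mean_scal.
  replace (polya_mean n x c (fun _ => a0)) with a0.
  - rewrite !polya_mean_falling by (assumption || lia).
    simpl rising; simpl INR; field.
    pose proof (Hpos 1%nat ltac:(lia)) as H1; pose proof (Hpos 2%nat ltac:(lia)) as H2;
    pose proof (Hpos 3%nat ltac:(lia)) as H3; simpl in H1, H2, H3.
    repeat split; lra.
  - transitivity (a0 * polya_mean n x c (fun k => rising (INR k) (-1) 0)).
    + rewrite polya_mean_falling by (assumption || lia); simpl; field.
    + rewrite <- polya_mean_scal; apply polya_mean_ext; intros; simpl; ring.
Qed.

Lemma polya_mean_le (n : nat) (x c : R) (g h : nat -> R) :
  (forall k, (k <= n)%nat -> 0 <= rising x c k * rising (1 - x) c (n - k)) ->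
  0 < rising 1 c n ->
  (forall k, (k <= n)%nat -> g k <= h k) ->
  polya_mean n x c g <= polya_mean n x c h.
Proof.
  intros Hw H1 Hgh; apply sum_Rle; intros k Hk.
  apply Rmult_le_compat_l; [|auto].
  apply Rmult_le_pos; [apply C_ge0|].
  apply Rmult_le_pos; [auto|].
  apply Rlt_le, Rinv_0_lt_compat; assumption.
Qed.

Lemma polya_mean_const (n : nat) (x c a : R) :
  (4 <= n)%nat ->
  (forall i : nat, (i < n)%nat -> 0 < 1 + INR i * c) ->
  polya_mean n x c (fun _ => a) = a.
Proof.
  intros Hn Hpos.
  rewrite (polya_mean_ext n x c _
    (fun k => a + 0 * rising (INR k) (-1) 1 + 0 * rising (INR k) (-1) 2
              + 0 * rising (INR k) (-1) 3 + 0 * rising (INR k) (-1) 4))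
    by (intros; ring).
  rewrite polya_mean_quartic by assumption; ring.
Qed.

Lemma polya_mean_centered (n : nat) (x c : R) :
  (4 <= n)%nat ->
  (forall i : nat, (i < n)%nat -> 0 < 1 + INR i * c) ->
  polya_mean n x c (fun k => INR k / INR n - x) = 0.
Proof.
  intros Hn Hpos.
  assert (Hn0 : INR n <> 0) by (apply not_0_INR; lia).
  rewrite (polya_mean_ext n x c _
    (fun k => - x + / INR n * rising (INR k) (-1) 1
              + 0 * rising (INR k) (-1) 2
              + 0 * rising (INR k) (-1) 3 + 0 * rising (INR k) (-1) 4))
    by (intros; simpl rising; simpl INR; field; assumption).
  rewrite polya_mean_quartic by assumption.
  rewrite !Rmult_0_l; field; assumption.
Qed.

(** Uses [k^2 = k(k-1) + k]. At [c = 0] this is the Bernstein variance [x(1-x)/n]; the factor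
    [1 + n c] later produces [1 - min(x, 1-x)]. *)
Lemma polya_variance (n : nat) (x c : R) :
  (4 <= n)%nat ->
  (forall i : nat, (i < n)%nat -> 0 < 1 + INR i * c) ->
  polya_mean n x c (fun k => (INR k / INR n - x) ^ 2)
  = x * (1 - x) * (1 + INR n * c) / (INR n * (1 + c)).
Proof.
  intros Hn Hpos.
  assert (Hn0 : INR n <> 0) by (apply not_0_INR; lia).
  pose proof (Hpos 1%nat ltac:(lia)) as H1; simpl in H1.
  rewrite (polya_mean_ext n x c _
    (fun k => x ^ 2
              + (1 - 2 * (INR n * x)) / INR n ^ 2 * rising (INR k) (-1) 1
              + / INR n ^ 2 * rising (INR k) (-1) 2
              + 0 * rising (INR k) (-1) 3 + 0 * rising (INR k) (-1) 4))
    by (intros; simpl rising; simpl INR; field; assumption).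
  rewrite polya_mean_quartic by assumption.
  rewrite !Rmult_0_l, !Rplus_0_r; simpl rising; simpl INR.
  field; split; lra.
Qed.

(* Coefficients from
   [k^4 = k(k-1)(k-2)(k-3) + 6 k(k-1)(k-2) + 7 k(k-1) + k] and its analogues in
   lower degree. *)
Lemma polya_fourth_moment (n : nat) (x c : R) :
  (4 <= n)%nat ->
  (forall i : nat, (i < n)%nat -> 0 < 1 + INR i * c) ->
  polya_mean n x c (fun k => (INR k / INR n - x) ^ 4)
  = x * (1 - x) * (1 + INR n * c)
    * (1 - c + 6 * (INR n * c) + 6 * (INR n * c) ^ 2
       + 3 * (x * (1 - x)) * (INR n - 2 - 6 * (INR n * c)
                              + INR n * (INR n * c) - 6 * (INR n * c) ^ 2))
    / (INR n ^ 3 * ((1 + c) * (1 + 2 * c) * (1 + 3 * c))).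
Proof.
  intros Hn Hpos.
  assert (Hn0 : INR n <> 0) by (apply not_0_INR; lia).
  pose proof (Hpos 1%nat ltac:(lia)) as H1; pose proof (Hpos 2%nat ltac:(lia)) as H2.
  pose proof (Hpos 3%nat ltac:(lia)) as H3; simpl in H1, H2, H3.
  set (u := INR n * x).
  rewrite (polya_mean_ext n x c _
    (fun k => x ^ 4
      + (1 - 4 * u + 6 * u ^ 2 - 4 * u ^ 3) / INR n ^ 4 * rising (INR k) (-1) 1
      + (7 - 12 * u + 6 * u ^ 2) / INR n ^ 4 * rising (INR k) (-1) 2
      + (6 - 4 * u) / INR n ^ 4 * rising (INR k) (-1) 3
      + / INR n ^ 4 * rising (INR k) (-1) 4))
    by (intros; unfold u; simpl rising; simpl INR; field; assumption).
  rewrite polya_mean_quartic by assumption.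
  unfold u; simpl rising; simpl INR.
  field; repeat split; lra.
Qed.

(** * Calculus relative to an interval *)

(** Clearing the denominator lets the estimate include [t = x], a point that the limit in [D_in]
    excludes. *)
Lemma D_in_bound (f f' : R -> R) (D : R -> Prop) (x eps : R) :
  D_in f f' D x -> 0 < eps ->
  exists d : R, 0 < d /\ forall t : R, D t -> Rabs (t - x) < d ->
    Rabs (f t - f x - f' x * (t - x)) <= eps * Rabs (t - x).
Proof.
  intros Hf Heps; destruct (Hf eps Heps) as [d [Hd H]].
  exists d; split; [exact Hd|]; intros t Dt Ht.
  destruct (Req_dec t x) as [->|Hne].
  - replace (f x - f x - f' x * (x - x)) with 0 by ring.
    rewrite Rabs_R0, Rminus_diag, Rabs_R0; lra.
  - assert (Hq : Rabs ((f t - f x) / (t - x) - f' x) < eps).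
    { apply H; repeat split; auto. }
    replace (f t - f x - f' x * (t - x))
      with (((f t - f x) / (t - x) - f' x) * (t - x)) by (field; lra).
    rewrite Rabs_mult; apply Rmult_le_compat_r; [apply Rabs_pos|lra].
Qed.

(** For [a <= b], the retraction of the line onto [[a, b]]; composing with it turns relative
    continuity into continuity on the whole line. *)
Definition clamp (a b t : R) : R := Rmax a (Rmin b t).

Lemma clamp_id (a b t : R) : a <= t <= b -> clamp a b t = t.
Proof.
  intros H; unfold clamp; rewrite Rmin_right, Rmax_right by lra; reflexivity.
Qed.

Lemma clamp_in (a b t : R) : a <= b -> a <= clamp a b t <= b.
Proof.
  intros H; unfold clamp, Rmax, Rmin.
  destruct (Rle_dec b t), (Rle_dec a _); lra.
Qed.

Lemma clamp_lipschitz (a b s t : R) :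
  a <= b -> Rabs (clamp a b s - clamp a b t) <= Rabs (s - t).
Proof.
  intros H; unfold clamp, Rmax, Rmin, Rabs.
  destruct (Rle_dec b t), (Rle_dec b s); repeat destruct (Rle_dec a _);
    repeat destruct (Rcase_abs _); lra.
Qed.

Lemma continuity_clamp (f : R -> R) (D : R -> Prop) (a b : R) :
  a <= b ->
  (forall t : R, a <= t <= b -> D t /\ continue_in f D t) ->
  continuity (fun t => f (clamp a b t)).
Proof.
  intros Hab Hf t eps Heps.
  pose proof (clamp_in a b t Hab) as Ht.
  destruct (proj2 (Hf _ Ht) eps Heps) as [d [Hd H]].
  exists d; split; [exact Hd|]; intros s [_ Hs].
  (* Distinct points may be clamped to the same one, where the punctured limit in [continue_in]
     gives nothing. Otherwise the same [d] works, [clamp] being 1-Lipschitz. *)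
  destruct (Req_dec (clamp a b s) (clamp a b t)) as [E|Hne].
  - rewrite E; simpl; unfold Rdist; rewrite Rminus_diag, Rabs_R0; exact Heps.
  - apply H; repeat split.
    + apply Hf, clamp_in, Hab.
    + intros E; apply Hne; symmetry; exact E.
    + simpl in *; unfold Rdist in *.
      apply Rle_lt_trans with (2 := Hs), clamp_lipschitz, Hab.
Qed.

(* The mean value theorem of the library asks for two-sided continuity at the
   end points, so it is applied to [f] composed with [clamp a b]. *)
Lemma MVT_D_in (f f' : R -> R) (D : R -> Prop) (a b : R) :
  a < b ->
  (forall t : R, a <= t <= b -> D t /\ D_in f f' D t) ->
  exists c : R, a < c < b /\ f b - f a = f' c * (b - a).
Proof.
  intros Hab Hf; set (g := fun t => f (clamp a b t)).
  assert (Hcont : continuity g).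
  { apply continuity_clamp with D; [lra|]; intros t Ht.
    destruct (Hf t Ht) as [Dt H]; split; [exact Dt|].
    exact (cont_deriv _ _ _ _ H). }
  assert (Hder : forall c : R, a < c < b -> derivable_pt_lim g c (f' c)).
  { intros c Hc; apply derivable_pt_lim_D_in; intros eps Heps.
    destruct (proj2 (Hf c ltac:(lra)) eps Heps) as [d [Hd H]].
    (* This radius keeps [t] inside [(a, b)], where [clamp] is the identity. *)
    exists (Rmin d (Rmin (c - a) (b - c))).
    split; [repeat apply Rmin_glb_lt; lra|].
    intros t [[_ Hne] Ht]; simpl in Ht; unfold Rdist in Ht.
    pose proof (Rmin_l d (Rmin (c - a) (b - c))).
    pose proof (Rmin_r d (Rmin (c - a) (b - c))).
    pose proof (Rmin_l (c - a) (b - c)); pose proof (Rmin_r (c - a) (b - c)).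
    assert (Hct : - (Rmin (c - a) (b - c)) < t - c < Rmin (c - a) (b - c))
      by (apply Rabs_def2 in Ht; lra).
    unfold g; rewrite !clamp_id by lra.
    apply H; repeat split; [apply Hf; lra|exact Hne|].
    simpl; unfold Rdist; lra. }
  (* Cauchy's form of the theorem, with the identity as second function. *)
  destruct (MVT g id a b
    (fun c Hc => exist _ (f' c) (Hder c Hc))
    (fun c _ => derivable_pt_id c) Hab
    (fun c _ => Hcont c)
    (fun c _ => derivable_continuous_pt _ _ (derivable_pt_id c)))
    as [c [Hc E]].
  rewrite derive_pt_id in E; simpl in E; unfold id, g in E.
  rewrite !clamp_id in E by lra.
  exists c; split; [exact Hc|lra].
Qed.

(** Treats both orders of the end points at once; the bound on [c - a] lets the intermediate point
    inherit a neighbourhood of [a] containing [b]. *)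
Lemma MVT_D_in_abs (f f' : R -> R) (D : R -> Prop) (a b : R) :
  (forall t : R, Rmin a b <= t <= Rmax a b -> D t /\ D_in f f' D t) ->
  exists c : R, Rmin a b <= c <= Rmax a b
    /\ Rabs (c - a) <= Rabs (b - a) /\ f b - f a = f' c * (b - a).
Proof.
  intros Hf; destruct (Rtotal_order a b) as [Hab|[->|Hab]].
  - rewrite Rmin_left, Rmax_right in * by lra.
    destruct (MVT_D_in f f' D a b Hab Hf) as [c [Hc E]].
    exists c; split; [lra|split; [|exact E]].
    rewrite !Rabs_pos_eq by lra; lra.
  - exists b; rewrite Rmin_left, Rmax_left by lra.
    split; [lra|split; [apply Rle_refl|ring]].
  - rewrite Rmin_right, Rmax_left in * by lra.
    destruct (MVT_D_in f f' D b a Hab Hf) as [c [Hc E]].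
    exists c; split; [lra|split; [|lra]].
    rewrite !Rabs_left1 by lra; lra.
Qed.

(* Near [x] the quadratic term suffices, by one application of the mean value
   theorem; away from [x] the remainder is bounded and the quartic term takes
   over. *)
Lemma taylor2_remainder (f f1 f2 : R -> R) (x eps : R) :
  C2_unit f f1 f2 -> unit_interval x -> 0 < eps ->
  exists A : R, 0 <= A /\ forall t : R, unit_interval t ->
    Rabs (f t - f x - f1 x * (t - x) - f2 x / 2 * (t - x) ^ 2)
    <= eps * (t - x) ^ 2 + A * (t - x) ^ 4.
Proof.
  intros hf hx Heps.
  set (r := fun t => f t - (f x + f1 x * (t - x) + f2 x / 2 * (t - x) ^ 2)).
  (* [r1] is both the derivative of [r] and the first-order remainder of [f1] at [x], so
     differentiability of [f1] makes it small. *)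
  set (r1 := fun t => f1 t - f1 x - f2 x * (t - x)).
  assert (Hr : forall t, unit_interval t -> D_in r r1 unit_interval t).
  { intros t Ht.
    apply (D_in_ext (fun t => f1 t - (f1 x + f2 x / 2 * (2 * (t - x))))).
    - unfold r1; field.
    - apply Dminus; [apply hf, Ht|].
      apply D_in_imp with no_cond; [exact (fun _ _ => I)|].
      apply derivable_pt_lim_D_in.
      (* The difference quotient of the quadratic polynomial misses its derivative by exactly
         [f2 x / 2 * h]; the [+ 1] keeps the denominator positive. *)
      intros e He; exists (mkposreal (e / (Rabs (f2 x) + 1))
        ltac:(pose proof (Rabs_pos (f2 x)); apply Rdiv_lt_0_compat; lra)).
      intros h Hh Hlt; simpl in Hlt.
      match goal with |- Rabs ?z < _ =>
        replace z with (f2 x / 2 * h) by (field; exact Hh) end.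
      pose proof (Rabs_pos (f2 x)); pose proof (Rabs_pos h).
      assert (Hb : Rabs h * (Rabs (f2 x) + 1) < e).
      { apply Rmult_lt_compat_r with (r := Rabs (f2 x) + 1) in Hlt; [|lra].
        replace (e / (Rabs (f2 x) + 1) * (Rabs (f2 x) + 1)) with e in Hlt
          by (field; lra); exact Hlt. }
      unfold Rdiv; rewrite !Rabs_mult, (Rabs_pos_eq (/ 2)) by lra; nra. }
  assert (Hr0 : r x = 0) by (unfold r; ring).
  destruct (D_in_bound f1 f2 unit_interval x eps) as [d [Hd Hnear]];
    [apply hf, hx|exact Heps|].
  (* Compactness of [[0, 1]] bounds the remainder globally by [M]. *)
  destruct (continuity_ab_maj (fun t => Rabs (r (clamp 0 1 t))) 0 1)
    as [s [Hmax _]]; [lra| |].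
  { intros t _.
    apply (continuity_pt_comp (fun t => r (clamp 0 1 t)) Rabs);
      [|apply Rcontinuity_abs].
    apply continuity_clamp with unit_interval; [lra|].
    intros u Hu; split; [exact Hu|]; exact (cont_deriv _ _ _ _ (Hr u Hu)). }
  set (M := Rabs (r (clamp 0 1 s))) in Hmax.
  assert (HM : 0 <= M) by apply Rabs_pos.
  assert (Hd4 : 0 < d ^ 4) by (apply pow_lt; exact Hd).
  (* With this coefficient the quartic term is at least [M] as soon as [|t - x| >= d]. *)
  exists (M / d ^ 4); split.
  { apply Rmult_le_pos; [exact HM|apply Rlt_le, Rinv_0_lt_compat, Hd4]. }
  intros t Ht.
  replace (f t - f x - f1 x * (t - x) - f2 x / 2 * (t - x) ^ 2) with (r t)
    by (unfold r; ring).
  assert (Hsq : 0 <= (t - x) ^ 2) by apply pow2_ge_0.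
  destruct (Rlt_le_dec (Rabs (t - x)) d) as [Hlt|Hge].
  - destruct (MVT_D_in_abs r r1 unit_interval x t) as [c [Hc [Hcx E]]].
    { intros u Hu; split; [|apply Hr]; unfold unit_interval in *;
        revert Hu; unfold Rmin, Rmax; destruct (Rle_dec x t); lra. }
    assert (Hcu : unit_interval c) by
      (unfold unit_interval in *; revert Hc; unfold Rmin, Rmax;
       destruct (Rle_dec x t); lra).
    replace (r t) with (r1 c * (t - x)) by lra.
    rewrite Rabs_mult.
    assert (H1 : Rabs (r1 c) <= eps * Rabs (t - x)).
    { apply Rle_trans with (eps * Rabs (c - x)); [apply Hnear; [exact Hcu|lra]|].
      apply Rmult_le_compat_l; lra. }
    assert (H2 : Rabs (t - x) * Rabs (t - x) = (t - x) ^ 2)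
      by (rewrite <- Rabs_mult, Rabs_pos_eq; nra).
    assert (H3 : 0 <= M / d ^ 4 * (t - x) ^ 4).
    { apply Rmult_le_pos; [|nra].
      apply Rmult_le_pos; [exact HM|apply Rlt_le, Rinv_0_lt_compat, Hd4]. }
    pose proof (Rabs_pos (t - x)); nra.
  - assert (Hrt : Rabs (r t) <= M).
    { specialize (Hmax t Ht); rewrite (clamp_id 0 1 t) in Hmax; assumption. }
    assert (H4 : d ^ 4 <= (t - x) ^ 4).
    { replace ((t - x) ^ 4) with (Rabs (t - x) ^ 4).
      - apply pow_incr; lra.
      - rewrite RPow_abs, Rabs_pos_eq; nra. }
    assert (H5 : M <= M / d ^ 4 * (t - x) ^ 4).
    { replace M with (M / d ^ 4 * d ^ 4) at 1 by (field; lra).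
      apply Rmult_le_compat_l; [|exact H4].
      apply Rmult_le_pos; [exact HM|apply Rlt_le, Rinv_0_lt_compat, Hd4]. }
    nra.
Qed.

(** * The operator *)

Lemma unit_variance_bounds (x : R) :
  unit_interval x -> 0 <= x * (1 - x) <= 1 / 4.
Proof.
  intros [Hx0 Hx1]; pose proof (pow2_ge_0 (x - 1 / 2)); split; nra.
Qed.

Lemma Rabs_le_inv (u a : R) : Rabs u <= a -> - a <= u <= a.
Proof.
  intros H; pose proof (Rle_abs u); pose proof (Rle_abs (- u)).
  rewrite Rabs_Ropp in *; lra.
Qed.

(** All follow from [(n - 1) c = - min(x, 1-x)] and [min(x, 1-x) <= 1/2]. The last identity shows
    that [n c] tends to [- min(x, 1-x)]. *)
Lemma incr_c_bounds (n : nat) (x : R) :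
  (2 <= n)%nat -> unit_interval x ->
  0 <= - incr_c n x <= / INR n
  /\ 0 <= 1 + INR n * incr_c n x
  /\ INR n * incr_c n x = incr_c n x - Rmin x (1 - x).
Proof.
  intros Hn [Hx0 Hx1]; apply le_INR in Hn; simpl in Hn.
  assert (Hm : 0 <= Rmin x (1 - x) <= 1 / 2).
  { split; [apply Rmin_glb; lra|].
    unfold Rmin; destruct (Rle_dec x (1 - x)); lra. }
  assert (E : incr_c n x * (INR n - 1) = - Rmin x (1 - x))
    by (unfold incr_c; field; lra).
  assert (Hinv : / INR n * INR n = 1) by (field; lra).
  assert (0 < / INR n) by (apply Rinv_0_lt_compat; lra).
  repeat split; nra.
Qed.

(* The largest index [i = n - 1] gives [y - min(x, 1-x) >= 0]: this is what makes
   the weights nonnegative. *)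
Lemma incr_c_nonneg (n i : nat) (x y : R) :
  (2 <= n)%nat -> (i < n)%nat -> unit_interval x -> Rmin x (1 - x) <= y ->
  0 <= y + INR i * incr_c n x.
Proof.
  intros Hn Hi Hx Hy.
  destruct (incr_c_bounds n x Hn Hx) as [Hc [_ E]].
  apply le_INR in Hi; rewrite S_INR in Hi; nra.
Qed.

Lemma incr_c_pos (n i : nat) (x : R) :
  (2 <= n)%nat -> (i < n)%nat -> unit_interval x ->
  0 < 1 + INR i * incr_c n x.
Proof.
  intros Hn Hi Hx.
  (* The base [1/2] already dominates the minimum, and the other half of 1 gives strictness. *)
  assert (Rmin x (1 - x) <= 1 / 2)
    by (unfold Rmin; destruct (Rle_dec x (1 - x)); lra).
  pose proof (incr_c_nonneg n i x (1 / 2) Hn Hi Hx ltac:(lra)); lra.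
Qed.

Lemma rop_weights_ge0 (n k : nat) (x : R) :
  (2 <= n)%nat -> (k <= n)%nat -> unit_interval x ->
  0 <= rising x (incr_c n x) k * rising (1 - x) (incr_c n x) (n - k).
Proof.
  intros Hn Hk Hx; apply Rmult_le_pos; apply rising_ge0; intros i Hi;
    apply incr_c_nonneg; try assumption; try lia; [apply Rmin_l|apply Rmin_r].
Qed.

(** With [m = min(x, 1-x)] and [n c = c - m], the difference is exactly [x(1-x) m c / (1 + c)]: a
    coefficient of size at most 1 times [c], and [|c| <= 1/n]. *)
Lemma rop_variance_dist_le (n : nat) (x : R) :
  (4 <= n)%nat -> unit_interval x ->
  Rabs (INR n * polya_mean n x (incr_c n x) (fun k => (INR k / INR n - x) ^ 2)
        - x * (1 - x) * (1 - Rmin x (1 - x))) <= / INR n.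
Proof.
  intros Hn Hx; rewrite polya_variance;
    [|assumption|intros i Hi; apply incr_c_pos; (assumption || lia)].
  destruct (incr_c_bounds n x ltac:(lia) Hx) as [Hc [_ E]].
  pose proof (incr_c_pos n 1 x ltac:(lia) ltac:(lia) Hx) as H1; simpl in H1.
  assert (HN : 4 <= INR n) by (apply le_INR in Hn; simpl in Hn; lra).
  rewrite E.
  set (c := incr_c n x) in *; set (m := Rmin x (1 - x)) in *.
  replace (INR n * (x * (1 - x) * (1 + (c - m)) / (INR n * (1 + c)))
           - x * (1 - x) * (1 - m))
    with (- (x * (1 - x) * m / (1 + c) * - c)) by (field; lra).
  assert (Hm : 0 <= m <= 1 / 2).
  { destruct Hx as [Hx0 Hx1]; split; [apply Rmin_glb; lra|].
    unfold m, Rmin; destruct (Rle_dec x (1 - x)); lra. }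
  assert (Hi : / INR n <= / 4) by (apply Rinv_le_contravar; lra).
  assert (Hw : 0 <= x * (1 - x) <= 1 / 4) by (apply unit_variance_bounds; assumption).
  assert (Hq : 0 <= x * (1 - x) * m / (1 + c) <= 1).
  { split.
    - apply Rmult_le_pos; [nra|apply Rlt_le, Rinv_0_lt_compat; lra].
    - apply Rmult_le_reg_r with (1 + c); [lra|].
      unfold Rdiv; rewrite Rmult_assoc, Rinv_l by lra; nra. }
  rewrite Rabs_Ropp, Rabs_pos_eq; nra.
Qed.

Lemma rop_variance_le1 (n : nat) (x : R) :
  (4 <= n)%nat -> unit_interval x ->
  INR n * polya_mean n x (incr_c n x) (fun k => (INR k / INR n - x) ^ 2) <= 1.
Proof.
  intros Hn Hx; pose proof (rop_variance_dist_le n x Hn Hx) as H.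
  apply Rabs_le_inv in H.
  assert (HN : 4 <= INR n) by (apply le_INR in Hn; simpl in Hn; lra).
  assert (/ INR n <= / 4) by (apply Rinv_le_contravar; lra).
  assert (0 <= Rmin x (1 - x)) by (destruct Hx as [Hx0 Hx1]; apply Rmin_glb; lra).
  assert (0 <= x * (1 - x) <= 1 / 4) by (apply unit_variance_bounds; assumption).
  nra.
Qed.

(** The constant comes from [(1/4) * 5 / (3/32) = 40/3 <= 14], the three numbers bounding
    [w (1 + s)], [B / N] and [P] below. *)
Lemma rop_fourth_moment_le (n : nat) (x : R) :
  (4 <= n)%nat -> unit_interval x ->
  INR n * polya_mean n x (incr_c n x) (fun k => (INR k / INR n - x) ^ 4)
  <= 14 / INR n.
Proof.
  intros Hn Hx; rewrite polya_fourth_moment;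
    [|assumption|intros i Hi; apply incr_c_pos; (assumption || lia)].
  destruct (incr_c_bounds n x ltac:(lia) Hx) as [Hc [Hs _]].
  assert (HN : 4 <= INR n) by (apply le_INR in Hn; simpl in Hn; lra).
  assert (Hi : / INR n <= / 4) by (apply Rinv_le_contravar; lra).
  assert (Hw : 0 <= x * (1 - x) <= 1 / 4) by (apply unit_variance_bounds; assumption).
  set (c := incr_c n x) in *; set (w := x * (1 - x)) in *.
  set (N := INR n) in *; set (s := N * c) in *.
  assert (Hs0 : s <= 0) by (unfold s; nra).
  set (B := 1 - c + 6 * s + 6 * s ^ 2
            + 3 * w * (N - 2 - 6 * s + N * s - 6 * s ^ 2)).
  set (P := (1 + c) * (1 + 2 * c) * (1 + 3 * c)).
  (* Since [- c <= 1/4], the three factors are at least [3/4], [1/2] and [1/4]. *)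
  assert (HP : 3 / 32 <= P).
  { assert (3 / 8 <= (1 + c) * (1 + 2 * c)) by nra.
    unfold P; nra. }
  (* Here [-1 <= s <= 0], so [6 s + 6 s^2 <= 0]; the rest is at most [5/4 + (3/4)(N + 4)]. *)
  assert (HB : B <= 5 * N).
  { assert (N - 2 - 6 * s + N * s - 6 * s ^ 2 <= N + 4) by nra.
    assert (3 * w * (N - 2 - 6 * s + N * s - 6 * s ^ 2) <= 3 * w * (N + 4))
      by (apply Rmult_le_compat_l; lra).
    unfold B; nra. }
  replace (N * (w * (1 + s) * B / (N ^ 3 * P)))
    with (w * (1 + s) * (B / N) / P / N) by (field; lra).
  apply Rmult_le_compat_r; [apply Rlt_le, Rinv_0_lt_compat; lra|].
  assert (HBN : B / N <= 5).
  { apply Rmult_le_reg_r with N; [lra|].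
    unfold Rdiv; rewrite Rmult_assoc, Rinv_l by lra; lra. }
  assert (Hws : 0 <= w * (1 + s) <= 1 / 4) by nra.
  apply Rmult_le_reg_r with P; [lra|].
  replace (w * (1 + s) * (B / N) / P * P) with (w * (1 + s) * (B / N))
    by (field; lra).
  nra.
Qed.

Theorem theorem5p6 (f f1 f2 : R -> R) (hf : C2_unit f f1 f2)
    (x : R) (hx : unit_interval x) :
  Un_cv (fun n : nat => INR n * (Rop n f x - f x))
        (1 / 2 * f2 x * (x * (1 - x)) * (1 - Rmin x (1 - x))).
Proof.
  intros eps Heps.
  destruct (taylor2_remainder f f1 f2 x (eps / 2) hf hx ltac:(lra))
    as [A [HA Hrem]].
  (* [K] collects the coefficients of [1/n]: the variance error and the quartic remainder. The [+ 1]
     makes it positive. *)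
  set (K := Rabs (f2 x / 2) + 14 * A + 1).
  assert (HK : 0 < K) by (unfold K; pose proof (Rabs_pos (f2 x / 2)); lra).
  destruct (archimed_cor1 (eps / 2 / K)) as [n0 [Hn0 Hn0pos]];
    [apply Rdiv_lt_0_compat; lra|].
  exists (max 4 n0); intros n Hn.
  assert (Hn4 : (4 <= n)%nat) by lia.
  assert (HN : 4 <= INR n) by (apply le_INR in Hn4; simpl in Hn4; lra).
  assert (Hpos : forall i : nat, (i < n)%nat -> 0 < 1 + INR i * incr_c n x)
    by (intros i Hi; apply incr_c_pos; (assumption || lia)).
  assert (Hsmall : K * / INR n < eps / 2).
  { assert (/ INR n <= / INR n0).
    { apply Rinv_le_contravar; [apply lt_0_INR; exact Hn0pos|].
      apply le_INR; lia. }
    replace (eps / 2) with (K * (eps / 2 / K)) by (field; lra).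
    apply Rmult_lt_compat_l; lra. }
  set (E := polya_mean n x (incr_c n x)).
  set (t := fun k => INR k / INR n).
  set (r := fun k => f (t k) - f x - f1 x * (t k - x)
                     - f2 x / 2 * (t k - x) ^ 2).
  assert (Hrop : Rop n f x
    = f x + f2 x / 2 * E (fun k => (t k - x) ^ 2) + E r).
  { change (Rop n f x) with (E (fun k => f (t k))); unfold E.
    rewrite (polya_mean_ext _ _ _ _
      (fun k => f x + f1 x * (t k - x) + f2 x / 2 * (t k - x) ^ 2 + r k))
      by (intros; unfold r; ring).
    rewrite !polya_mean_plus, !polya_mean_scal, polya_mean_const by assumption.
    unfold t at 1; rewrite polya_mean_centered by assumption; ring. }
  set (h := fun k => eps / 2 * (t k - x) ^ 2 + A * (t k - x) ^ 4).
  assert (Hrh : forall k, (k <= n)%nat -> Rabs (r k) <= h k).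
  { intros k Hk; apply Hrem; unfold t; split.
    - apply Rmult_le_pos; [apply pos_INR|apply Rlt_le, Rinv_0_lt_compat; lra].
    - apply Rmult_le_reg_r with (INR n); [lra|].
      unfold Rdiv; rewrite Rmult_assoc, Rinv_l by lra.
      apply le_INR in Hk; lra. }
  assert (HEr : Rabs (E r) <= E h).
  { assert (Hw : forall k, (k <= n)%nat -> 0 <=
        rising x (incr_c n x) k * rising (1 - x) (incr_c n x) (n - k))
      by (intros; apply rop_weights_ge0; (assumption || lia)).
    assert (Hd : 0 < rising 1 (incr_c n x) n) by (apply rising_gt0; exact Hpos).
    apply Rabs_le; split.
    (* Both sides of the absolute value follow from monotonicity of the mean, which needs
       nonnegative weights. *)
    - replace (- E h) with (E (fun k => -1 * h k))
        by (unfold E; rewrite polya_mean_scal; ring).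
      apply polya_mean_le; try assumption.
      intros k Hk; specialize (Hrh k Hk); apply Rabs_le_inv in Hrh; lra.
    - apply polya_mean_le; try assumption.
      intros k Hk; specialize (Hrh k Hk); apply Rabs_le_inv in Hrh; lra. }
  (* As [n] times the variance is at most 1, the quadratic part costs only [eps / 2]. *)
  assert (HEh : INR n * E h <= eps / 2 + A * (14 / INR n)).
  { unfold E, h; rewrite polya_mean_plus, !polya_mean_scal.
    pose proof (rop_variance_le1 n x Hn4 hx) as H2.
    pose proof (rop_fourth_moment_le n x Hn4 hx) as H4.
    change (fun k => (INR k / INR n - x) ^ 2) with (fun k => (t k - x) ^ 2) in H2.
    change (fun k => (INR k / INR n - x) ^ 4) with (fun k => (t k - x) ^ 4) in H4.
    nra. }
  pose proof (rop_variance_dist_le n x Hn4 hx) as Hvar.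
  fold E in Hvar.
  change (fun k => (INR k / INR n - x) ^ 2) with (fun k => (t k - x) ^ 2) in Hvar.
  unfold Rdist; rewrite Hrop.
  set (V := E (fun k => (t k - x) ^ 2)) in *.
  (* The error splits into the variance discrepancy and the averaged Taylor remainder, together less
     than [eps / 2 + K / n < eps]. *)
  replace (INR n * (f x + f2 x / 2 * V + E r - f x)
           - 1 / 2 * f2 x * (x * (1 - x)) * (1 - Rmin x (1 - x)))
    with (f2 x / 2 * (INR n * V - x * (1 - x) * (1 - Rmin x (1 - x)))
          + INR n * E r) by field.
  eapply Rle_lt_trans; [apply Rabs_triang|].
  rewrite !Rabs_mult, (Rabs_pos_eq (INR n)) by lra.
  assert (INR n * Rabs (E r) <= INR n * E h)
    by (apply Rmult_le_compat_l; lra).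
  assert (Rabs (f2 x / 2)
            * Rabs (INR n * V - x * (1 - x) * (1 - Rmin x (1 - x)))
          <= Rabs (f2 x / 2) * / INR n)
    by (apply Rmult_le_compat_l; [apply Rabs_pos|exact Hvar]).
  assert (0 < / INR n) by (apply Rinv_0_lt_compat; lra).
  unfold K, Rdiv in *; lra.
Qed.
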